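(* Let $d\ge 2$ be an integer and let $G$ be a finite simple $2d$-regular graph with connected components $G_1,G_2,\ldots,G_q$, where $G_1,\ldots,G_k$ ($0\le k\le q$) are exactly the components with an odd number of vertices, indexed so that $|G_1|\le |G_2|\le\cdots\le |G_k|$. Then: (1) If $0\le k\le 5d+4$, then $G$ admits an antimagic orientation. (2) If $k\ge 5d+5$, let $x_0$ be a positive integer satisfying one of the equations $k=(2d-2)(x+2)+r$ for some $r\in\{0,1,\ldots,d+8\}$, or $k=(2d-2)(x+1)+r$ for some $r\in\{d+9,d+10,\ldots,2d-3\}$ (the paper refers to $x_0$ as the unique positive integer solution of one of these equations). If $|G_1|\ge 2x_0+5$, then $G$ admits an antimagic orientation. *)

(* Defs.v *)
From HB Require Import structures.
From mathcomp Require Import all_boot all_order all_algebra.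
Set Implicit Arguments. Unset Strict Implicit. Unset Printing Implicit Defensive.
Import Order.TTheory GRing.Theory Num.Theory.

Definition simple_graph (V : finType) (e : rel V) : Prop :=
  symmetric e /\ irreflexive e.

Definition regular (V : finType) (e : rel V) (r : nat) : Prop :=
  forall v : V, #|[set w | e v w]| = r.

Definition edges (V : finType) (e : rel V) : {set {set V}} :=
  [set [set x.1; x.2] | x in [set x : V * V | e x.1 x.2]].

Definition component (V : finType) (e : rel V) (v : V) : {set V} :=
  [set w | connect e v w].
Definition components (V : finType) (e : rel V) : {set {set V}} :=
  [set component e v | v in V].
Definition odd_components (V : finType) (e : rel V) : {set {set V}} :=
  [set C in components e | odd #|C|].

(* An orientation of e: o u v means the edge uv is directed from u to v. *)
Definition orientation (V : finType) (e : rel V) (o : rel V) : Prop :=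
  (forall u v, o u v -> e u v) /\
  (forall u v, e u v -> o u v || o v u) /\
  (forall u v, ~~ (o u v && o v u)).

(* A labeling: bijection from the edge set onto {1, ..., |E|}. *)
Definition edge_labeling (V : finType) (e : rel V) (f : {set V} -> nat) : Prop :=
  {in edges e &, injective f} /\
  (forall A, A \in edges e -> 0 < f A <= #|edges e|).

Definition vertex_sum (V : finType) (o : rel V) (f : {set V} -> nat) (v : V) : int :=
  (\sum_(u | o u v) ((f [set u; v])%:Z) - \sum_(w | o v w) ((f [set v; w])%:Z))%R.

Definition has_antimagic_orientation (V : finType) (e : rel V) : Prop :=
  exists (o : rel V) (f : {set V} -> nat),
    [/\ orientation e o, edge_labeling e f & injective (vertex_sum o f)].

(* Main.v *)
Require Import Defs.
From HB Require Import structures.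
From mathcomp Require Import all_boot all_order all_algebra.
From mathcomp Require Import zify.
Set Implicit Arguments. Unset Strict Implicit. Unset Printing Implicit Defensive.

(**
A longest trail in a graph with even degrees is closed and uses every edge at
each of its vertices, so the edges of a 2d-regular graph split into
vertex-disjoint closed trails, each passing d times through each of its
vertices.  Cut each trail at the first visit to every vertex: a trail with n
vertices becomes a cyclic sequence of n chunks, and each vertex is a cut point
once and an interior point of chunks d - 1 times.  Orient the chunks alternately
forwards and backwards and label each of them by an interval of consecutive
integers, increasing along its orientation.  An interior passage contributes -1,
so up to the constant d - 1 the sum at a vertex is: the sum of two last labels
(a sink), minus the sum of two first labels (a source), or, for the starting
vertex of a trail with an odd number n of chunks, the last label of the last
chunk minus the first label of the first one.

It remains to order the chunks.  If the pairs of chunks meeting at the sinks form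
a chain for componentwise comparison, then the sums at the sinks are distinct;
likewise for the sources.  For even trails one proceeds trail by trail,
alternately from both ends.  The odd trails are treated simultaneously and come
first: all their first chunks (which consist of a single edge), then for each of
them its last two chunks, and then alternately one more chunk from the front of
each and one more from the back of each, always in order of increasing number of
chunks.  From one odd trail to the next the first label of the first chunk
increases by 1 and the last label of the last chunk by at least 2, so their
starting vertices have distinct sums, which are positive and smaller than the
sums at the sinks.
*)

(** * Closed trails *)

Section Trails.
Variable V : finType.
Implicit Types (a b u v x y : V) (p q : seq V) (s : seq (V * V)) (e : rel V).

Definition arcs x p : seq (V * V) := pairmap pair x p.

Definition mult a b s := count_mem (a, b) s + count_mem (b, a) s.

Lemma arcs_cat x p q : arcs x (p ++ q) = arcs x p ++ arcs (last x p) q.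
Proof. exact: pairmap_cat. Qed.

Lemma arcs_rcons x p y : arcs x (rcons p y) = rcons (arcs x p) (last x p, y).
Proof. by rewrite -cats1 arcs_cat /= cats1. Qed.

Lemma mult_cat a b s t : mult a b (s ++ t) = mult a b s + mult a b t.
Proof. by rewrite /mult !count_cat; lia. Qed.

Lemma mult_perm a b s t : perm_eq s t -> mult a b s = mult a b t.
Proof. by move=> /permP st; rewrite /mult !st. Qed.

Lemma multC a b s : mult a b s = mult b a s.
Proof. by rewrite /mult addnC. Qed.

Lemma count_belast v x p :
  count_mem v (belast x p) + (last x p == v) = (x == v) + count_mem v p.
Proof.
have := congr1 (count_mem v) (lastI x p).
by rewrite -cats1 count_cat /= => ->; lia.
Qed.

(** Each arc is counted once at its tail, listed by [belast], and once at its head, listed by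
    [p]. *)
Lemma sum_mult v x p :
  \sum_b mult v b (arcs x p) = count_mem v (belast x p) + count_mem v p.
Proof.
elim: p x => [|y p IHp] x /=; first by rewrite big1.
have -> : \sum_b mult v b ((x, y) :: arcs y p) =
    \sum_b (((x == v) && (b == y)) + ((y == v) && (b == x))) +
    \sum_b mult v b (arcs y p).
  rewrite -big_split; apply: eq_bigr => b _.
  by rewrite /mult /= !xpair_eqE (eq_sym y b) (eq_sym x b) (andbC (b == x)); lia.
rewrite IHp big_split /=.
have E w (c : bool) : \sum_b (c && (b == w)) = c :> nat.
  case: c => /=; last by rewrite big1.
  by rewrite -big_mkcond /= big_pred1_eq.
by rewrite !E; lia.
Qed.

(** The Boolean [e a b] is read as 0 or 1, so one bound says both that every step is an edge and
    that no edge is used twice. *)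
Definition trail e x p := [forall a, forall b, mult a b (arcs x p) <= e a b].

Lemma trailP e x p :
  reflect (forall a b, mult a b (arcs x p) <= e a b) (trail e x p).
Proof.
apply: (iffP forallP) => [H a b|H a]; first by have /forallP := H a.
by apply/forallP.
Qed.

Lemma trail_path e x p : trail e x p -> path e x p.
Proof.
move/trailP; elim: p x => //= y p IHp x H; apply/andP; split; last first.
  by apply: IHp => a b; apply: leq_trans (H a b); rewrite /mult /=; lia.
by have := H x y; rewrite /mult /= eqxx; case: (e x y) => //; lia.
Qed.

(** Bounds the length, so that a longest trail exists. *)
Lemma trail_size e x p : trail e x p -> size p <= #|{: V * V}|.
Proof.
move/trailP=> H; rewrite -(size_pairmap pair x p) -/(arcs x p).
suff /card_uniqP <- : uniq (arcs x p) by exact: max_card.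
apply: count_mem_uniq => -[a b]; have := H a b; rewrite /mult.
case: (boolP (_ \in _)) => [|/count_memPn -> //].
by rewrite -has_pred1 has_count; case: (e a b) => /=; case: (count _ _) => [|[|?]] //; case: (count _ _).
Qed.

Lemma trail_rcons e x p y :
    symmetric e -> irreflexive e -> trail e x p -> e (last x p) y ->
    mult (last x p) y (arcs x p) = 0 ->
  trail e x (rcons p y).
Proof.
move=> esym eirr /trailP tr exy m0; apply/trailP=> a b.
rewrite arcs_rcons -cats1 mult_cat [mult a b [:: _]]/mult /= !xpair_eqE.
have := tr a b.
case: (altP (last x p =P a)) => [Ea|_] /=; last first.
  case: (altP (last x p =P b)) => [Eb|_] /=; last by lia.
  case: (altP (y =P a)) => [Ea|_] /=; last by lia.
  by move: exy m0; rewrite Eb Ea multC => eba ->; rewrite esym eba.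
case: (altP (y =P b)) => [Eb|_] /=; last first.
  case: (altP (last x p =P b)) => [Eb|_] /=; last by lia.
  case: (altP (y =P a)) => [Ea'|_] /=; last by lia.
  by move: exy; rewrite Ea' Ea eirr.
move: exy m0; rewrite Ea Eb => eab ->.
case: (altP (a =P b)) => [ab|_] /=; first by rewrite ab eirr in eab.
by rewrite eab.
Qed.

Lemma closed_trail_rot e x p u :
    trail e x p -> last x p = x -> u \in p ->
  exists q, [/\ trail e u q, last u q = u, size q = size p &
                perm_eq (arcs u q) (arcs x p)].
Proof.
move=> tr lp up; case/splitPr: up tr lp => p1 p2 tr lp.
rewrite last_cat /= in lp; exists (p2 ++ rcons p1 u).
have E : perm_eq (arcs u (p2 ++ rcons p1 u)) (arcs x (p1 ++ u :: p2)).
  by rewrite arcs_cat lp -cat_rcons (arcs_cat x (rcons p1 u)) last_rcons perm_catC.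
split=> //; last 1 first.
- by rewrite !size_cat size_rcons /=; lia.
- by apply/trailP=> a b; rewrite (mult_perm _ _ E); move/trailP: tr.
- by rewrite last_cat last_rcons.
Qed.

(* A longest trail cannot be extended; comparing parities of degrees at its
   last vertex it is closed, and being closed it may be rotated so as to end at
   any of its vertices. *)
Lemma saturated_closed_trail e x0 y0 :
    symmetric e -> irreflexive e -> (forall v, ~~ odd (\sum_w e v w)) ->
    e x0 y0 ->
  exists x p, [/\ trail e x p, 0 < size p, last x p = x &
                  forall u w, u \in p -> e u w -> mult u w (arcs x p) = 1].
Proof.
move=> esym eirr even exy.
pose P n := [exists x, exists t : n.-tuple V, trail e x t].
have tr0 : trail e x0 [::] by apply/trailP.
have P1 : P 1.
  apply/existsP; exists x0; apply/existsP; exists [tuple y0] => /=.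
  exact: (trail_rcons esym eirr tr0).
have Pb n : P n -> n <= #|{: V * V}|.
  case/existsP=> x /existsP[t tr]; rewrite -(size_tuple t); exact: trail_size tr.
case: (ex_maxnP (ex_intro P 1 P1) Pb) => m /existsP[x /existsP[t tr]] max.
have maxT y q : trail e y q -> size q <= m.
  move=> tq; apply: (max (size q)); apply/existsP; exists y; apply/existsP.
  by exists (in_tuple q).
have sat y q : size q = m -> trail e y q ->
    forall w, e (last y q) w -> mult (last y q) w (arcs y q) = 1.
  move=> sq tq w elw; have := trailP _ _ _ tq (last y q) w; rewrite elw.
  case: (posnP (mult (last y q) w (arcs y q))) => [m0|]; last by lia.
  have := maxT y (rcons q w) (trail_rcons esym eirr tq elw m0).
  by rewrite size_rcons; lia.
have st := size_tuple t.
have cl : last x t = x.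
  (* If the trail ended elsewhere, its last vertex would be a head once more often than a tail, and
     by saturation its degree would be this odd total. *)
  apply/eqP; apply: contraT => nx; have := even (last x t).
  have -> : \sum_w e (last x t) w = \sum_w mult (last x t) w (arcs x t).
    apply: eq_bigr => w _; have := trailP _ _ _ tr (last x t) w.
    by case E: (e _ w); [rewrite (sat _ _ st tr _ E)|case: mult].
  rewrite sum_mult; have := count_belast (last x t) x t.
  by rewrite eqxx eq_sym (negPf nx); lia.
exists x, t; split=> //; first by rewrite st; exact: max P1.
move=> u w ut euw.
have [q [tq lq sq pq]] := closed_trail_rot tr cl ut.
by rewrite -(mult_perm _ _ pq) -{1}lq; apply: sat; rewrite ?lq // sq.
Qed.

End Trails.

(** * Cutting the trails into chunks *)

Section Chunks.
Variable V : finType.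
Implicit Types (a b u v x y : V) (p q : seq V) (e : rel V).

(** Induction from the right: a step to a new vertex closes a chunk, a step to an old one joins the
    remainder [r]. The start [x] counts as visited, so returning to it closes no chunk. *)
Lemma first_visit_chunks x y p : y != x ->
  exists cs r, [/\ y :: p = flatten cs ++ r, all (predC1 [::]) cs,
    uniq (x :: map (last x) cs), {subset y :: p <= x :: map (last x) cs} &
    head [::] cs = [:: y]].
Proof.
move=> yx; elim/last_ind: p => [|p z [cs [r [E nn un sub hd]]]].
  exists [:: [:: y]], [::]; split=> //=; first by rewrite inE eq_sym yx.
  by move=> w; rewrite !inE => ->; rewrite orbT.
have sub' (s : seq V) : {subset x :: map (last x) cs <= s} -> z \in s ->
    {subset y :: rcons p z <= s}.
  move=> ss zs t; rewrite -rcons_cons mem_rcons inE => /orP[/eqP-> //|tp].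
  by apply: ss; apply: sub.
have [zin|znin] := boolP (z \in x :: map (last x) cs).
  exists cs, (rcons r z); split=> //; last exact: sub'.
  by rewrite -rcons_cons E rcons_cat.
exists (rcons cs (rcons r z)), [::]; split.
- by rewrite -rcons_cons E cats0 flatten_rcons rcons_cat.
- by rewrite all_rcons nn andbT /= -size_eq0 size_rcons.
- by rewrite map_rcons last_rcons -rcons_cons rcons_uniq znin un.
- rewrite map_rcons last_rcons -(rcons_cons x); apply: sub'.
    by move=> w; rewrite mem_rcons inE => ->; rewrite orbT.
  by rewrite mem_rcons mem_head.
- by case: cs hd {E nn un sub sub' znin}.
Qed.

(** The stretch after the last first visit returns to [x] and becomes the final chunk. *)
Lemma closed_walk_chunks x y p : y != x -> last y p = x ->
  exists us cs, [/\ y :: p = flatten cs, all (predC1 [::]) cs,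
    uniq (x :: us), {subset y :: p <= x :: us} &
    head [::] cs = [:: y] /\ map (last x) cs = rcons us x].
Proof.
move=> yx lp; have [cs [r [E nn un sub hd]]] := first_visit_chunks p yx.
exists (map (last x) cs), (rcons cs r).
have lr : last x r = x.
  have := congr1 (last x) E; rewrite /= lp last_cat => ->.
  by case: r E => //=; elim: (cs).
split=> //; last 1 first.
- by rewrite map_rcons lr; split=> //; case: (cs) hd.
- by rewrite flatten_rcons.
(* With an empty remainder the last chunk of [cs] would end at [x], which [un] forbids. *)
rewrite all_rcons nn andbT /=; apply/negP=> /eqP r0.
move: E; rewrite r0 cats0 => E; have := congr1 (last x) E; rewrite /= lp.
case/lastP: cs hd nn un {sub E} => // cs c _.
rewrite all_rcons => /andP[cn _]; rewrite map_rcons flatten_rcons last_cat.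
case: c cn => // z c _ /=; rewrite mem_rcons inE negb_or => /andP[/andP[h _] _].
by move=> h'; rewrite {1}h' eqxx in h.
Qed.

Lemma arcs_flatten x0 x (cs : seq (seq V)) : all (predC1 [::]) cs ->
  arcs x (flatten cs) =
  flatten [seq arcs z.1 z.2 | z <- zip (x :: map (last x0) cs) cs].
Proof.
elim: cs x => [|c cs IHcs] x //= /andP[cn nn].
by rewrite arcs_cat IHcs //; case: c cn.
Qed.

Lemma mult_flatten a b (ss : seq (seq (V * V))) :
  mult a b (flatten ss) = \sum_(s <- ss) mult a b s.
Proof.
by elim: ss => [|s ss IH]; rewrite ?big_nil // big_cons /= mult_cat IH.
Qed.

Definition act e v := [exists w, e v w].

(** Every vertex is a cut point once, so chunks are indexed by their first vertex: [sg v] lists the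
    chunk from [v] without [v] itself. It is chunk number [pos v] of the [len v] chunks of its
    trail, and [root v] identifies the trail. *)
Record chunking e (sg : V -> seq V) (pos len : V -> nat) (root : V -> V)
    : Prop := Chunking {
  chunk0 v : ~~ act e v -> sg v = [::];
  chunk_gt0 v : act e v -> 0 < size (sg v);
  chunk_last v : act e v -> let n := last v (sg v) in
    [/\ act e n, root n = root v &
        pos n = if (pos v).+1 == len v then 0 else (pos v).+1];
  pos_lt v : act e v -> pos v < len v;
  pos_inj u v : act e u -> act e v -> root u = root v -> pos u = pos v -> u = v;
  len_root u v : act e u -> act e v -> root u = root v -> len u = len v;
  root_act v : act e v -> act e (root v);
  root_edge u v : e u v -> root u = root v;
  chunk1 v : act e v -> pos v = 0 -> size (sg v) = 1;
  chunk_mult a b : \sum_v mult a b (arcs v (sg v)) = e a b }.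

(** Induction on the number of non-isolated vertices. A saturated closed trail uses all edges at its
    vertices, so its vertex set [U] is closed under adjacency, and deleting these edges keeps all
    degrees even. *)
Lemma chunkingP e :
    symmetric e -> irreflexive e -> (forall v, ~~ odd (\sum_w e v w)) ->
  exists sg pos len root, chunking e sg pos len root.
Proof.
have [n] := ubnP #|[set v | act e v]|.
elim: n e => // n IHn e; rewrite ltnS => le_n esym eirr even.
have [/existsP[x0 /existsP[y0 exy]]|noedge] := boolP [exists v, act e v];
  last first.
  have na v : act e v = false.
    by apply/negbTE; apply: contra noedge => av; apply/existsP; exists v.
  exists (fun=> [::]), (fun=> 0), (fun=> 0), id; split=> //; try by move=> v; rewrite na.
  - by move=> u v euv; have := na u; rewrite /act => /existsP[]; exists v.
  - move=> a b; rewrite big1 //; case E: (e a b) => //.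
    by have := na a; rewrite /act => /existsP[]; exists b.
have [x [p [tr p0 lp sat]]] := saturated_closed_trail esym eirr even exy.
case: p tr p0 lp sat => // y p tr _ /= lp sat.
have exy1 : e x y by have /= /andP[] := trail_path tr.
have yx : y != x by apply: contraTneq exy1 => ->; rewrite eirr.
have [us [cs [Ep nn un sub [hd ls]]]] := closed_walk_chunks yx lp.
set U := x :: us in un sub.
have sU : size cs = size U by rewrite -(size_map (last x)) ls size_rcons.
have xp : x \in y :: p by rewrite -lp mem_last.
have Up : {subset U <= y :: p}.
  move=> u; rewrite inE => /orP[/eqP->//|uus].
  have : u \in map (last x) cs by rewrite ls mem_rcons inE uus orbT.
  case/mapP=> c cin ->; rewrite Ep; apply/flattenP; exists c => //.
  by have := allP nn c cin; case: (c) => //= z c' _; exact: mem_last.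
have Usat u w : u \in U -> e u w -> mult u w (arcs x (y :: p)) = 1.
  by move=> /Up; apply: sat.
have multU a b : 0 < mult a b (arcs x (y :: p)) -> (a \in U) && (b \in U).
  have H s z : forall c d, (c, d) \in arcs z s -> (c \in z :: s) && (d \in z :: s).
    elim: s z => //= t s IHs z c d; rewrite inE => /orP[/eqP[-> ->]|/IHs].
      by rewrite mem_head inE mem_head orbT.
    by case/andP=> c1 d1; rewrite inE c1 orbT inE d1 orbT.
  have subx : {subset x :: y :: p <= U}.
    by move=> z; rewrite inE => /orP[/eqP->|/sub//]; rewrite mem_head.
  rewrite /mult addn_gt0 -!has_count !has_pred1 => /orP[]/H/andP[c1 c2].
    by rewrite !subx.
  by rewrite !subx.
have Ucl u w : e u w -> (u \in U) = (w \in U).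
  move=> euw; apply/idP/idP => [uU|wU].
    by have := Usat _ _ uU euw; have := multU u w; case: mult => // k /(_ isT)/andP[].
  have ewu : e w u by rewrite esym.
  by have := Usat _ _ wU ewu; have := multU w u; case: mult => // k /(_ isT)/andP[].
pose e' := [rel u w | e u w && (u \notin U)].
have act' v : act e' v = act e v && (v \notin U).
  rewrite /act; apply/existsP/andP=> [[w /andP[evw vU]]|[/existsP[w evw] vU]].
    by split=> //; apply/existsP; exists w.
  by exists w; rewrite /= evw.
have e's : symmetric e'.
  move=> u w /=; rewrite esym; case E: (e w u) => //=.
  by rewrite (Ucl _ _ E).
have e'i : irreflexive e' by move=> u /=; rewrite eirr.
have e'e v : ~~ odd (\sum_w e' v w).
  case vU: (v \in U); first by rewrite big1 // => w _; rewrite /= vU andbF.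
  by under eq_bigr => w _ do rewrite /= vU andbT.
have actU v : v \in U -> act e v.
  move=> vU; have := Up v vU; rewrite /act => vp.
  have := trail_path tr; case/splitPr: vp => p1 p2; rewrite cat_path /=.
  case/and3P=> _ E _; apply/existsP; exists (last x p1); by rewrite esym.
have lt' : #|[set v | act e' v]| < n.
  apply: leq_trans le_n; apply: proper_card; apply/properP; split.
    by apply/subsetP=> v; rewrite !inE act' => /andP[].
  exists x; first by rewrite inE actU ?mem_head.
  by rewrite inE act' mem_head andbF.
have [sg [pos [len [root [c0 cgt cl plt pinj lroot ract redge c1 cm]]]]] :=
  IHn e' lt' e's e'i e'e.
(* The new trail occupies [U], numbered by first visits; the other vertices keep their chunks from
   [e']. *)
pose sg1 v := if v \in U then nth [::] cs (index v U) else sg v.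
pose pos1 v := if v \in U then index v U else pos v.
pose len1 v := if v \in U then size U else len v.
pose root1 v := if v \in U then x else root v.
have actn v : act e v -> v \notin U -> act e' v by rewrite act' => -> ->.
have rootn v : act e v -> v \notin U -> root v \notin U.
  by move=> av vU; have := ract v (actn v av vU); rewrite act' => /andP[].
have root1E u v : act e u -> act e v -> root1 u = root1 v -> (u \in U) = (v \in U).
  move=> au av; rewrite /root1; case: ifPn => uU; case: ifPn => vU // E.
    by have := rootn v av vU; rewrite -E mem_head.
  by have := rootn u au uU; rewrite E mem_head.
have nthc v : v \in U -> last v (nth [::] cs (index v U)) = nth x (rcons us x) (index v U).
  move=> vU; rewrite -ls (nth_map [::]) ?sU ?index_mem //.
  have : nth [::] cs (index v U) \in cs by rewrite mem_nth // sU index_mem.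
  by move/(allP nn); case: nth.
exists sg1, pos1, len1, root1; split.
- move=> v nv; rewrite /sg1; case: ifPn => vU; first by rewrite actU in nv.
  by apply: c0; rewrite act' negb_and nv.
- move=> v av; rewrite /sg1; case: ifPn => vU; last by apply: cgt; exact: actn.
  have : nth [::] cs (index v U) \in cs by rewrite mem_nth // sU index_mem.
  by move/(allP nn); case: nth.
- move=> v av; rewrite /sg1 /=; case: (boolP (v \in U)) => vU; last first.
    have [l1 l2 l3] := cl v (actn v av vU); move: l1; rewrite act' => /andP[l1 l1'].
    by rewrite /root1 /pos1 /len1 (negbTE vU) (negbTE l1').
  rewrite nthc //; set z := nth _ _ _.
  have iv : index v U < size U by rewrite index_mem.
  have [zU pz] : z \in U /\ index z U = if (index v U).+1 == size U then 0 else (index v U).+1.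
    rewrite /z nth_rcons; case: ifPn => [lt|].
      have -> : nth x us (index v U) = nth x U (index v U).+1 by [].
      split; first by rewrite mem_nth.
      by rewrite index_uniq // ifF //; move: lt; rewrite /=; lia.
    rewrite -leqNgt => ge; have -> : (index v U == size us).
      by move: iv ge; rewrite [size U]/=; lia.
    split; first exact: mem_head.
    have -> : (index v U).+1 == size U by move: iv ge; rewrite [size U]/=; lia.
    by rewrite /= eqxx.
  by rewrite /root1 /pos1 /len1 vU zU; split=> //; exact: actU.
- move=> v av; rewrite /pos1 /len1; case: ifPn => vU; first by rewrite index_mem.
  by apply: plt; exact: actn.
- move=> u v au av rE; have := root1E _ _ au av rE; move: rE.
  rewrite /root1 /pos1; case: ifPn => uU; case: ifPn => vU // rE _ pE; last first.
    by apply: pinj => //; exact: actn.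
  by rewrite -(nth_index x uU) pE nth_index.
- move=> u v au av rE; have := root1E _ _ au av rE; move: rE.
  rewrite /root1 /len1; case: ifPn => uU; case: ifPn => vU // rE _.
  by apply: lroot => //; exact: actn.
- move=> v av; rewrite /root1; case: ifPn => vU; first by rewrite actU ?mem_head.
  by have := ract v (actn v av vU); rewrite act' => /andP[].
- move=> u v euv; rewrite /root1 (Ucl _ _ euv); case: ifPn => // vU.
  by apply: redge; rewrite /= euv (Ucl _ _ euv).
- move=> v av; rewrite /pos1 /sg1; case: ifPn => vU; last by apply: c1; exact: actn.
  by move=> i0; rewrite i0 nth0 hd.
- move=> a b; rewrite (bigID (mem U)) /=.
  have -> : \sum_(v in U) mult a b (arcs v (sg1 v)) = mult a b (arcs x (y :: p)).
    rewrite Ep (arcs_flatten x x nn) ls mult_flatten big_map -big_uniq //=.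
    rewrite (big_nth x) (big_nth (x, [::])) size_zip /= size_rcons sU /=.
    rewrite (minn_idPr _) // !big_nat; apply: eq_bigr => i /andP[_ lti].
    have -> : nth (x, [::]) (zip (x :: rcons us x) cs) i = (nth x U i, nth [::] cs i).
      (* The list of starts has the final [x] in surplus, and [zip] drops it. *)
      have -> : zip (x :: rcons us x) cs = zip U cs.
        rewrite -rcons_cons -/U; clear -sU; elim: cs U sU => [|c cs IH] [|z U] //= [sU].
        by rewrite IH.
      by rewrite nth_zip.
    by rewrite /sg1 mem_nth // index_uniq.
  have -> : \sum_(v | v \notin U) mult a b (arcs v (sg1 v)) = e' a b.
    rewrite -cm (bigID (mem U) predT) /= [X in _ = X + _]big1 ?add0n.
      by apply: eq_bigr => v vU; rewrite /sg1 (negbTE vU).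
    by move=> v vU; rewrite c0 // act' vU andbF.
  (* An edge is used once by the new trail if it meets [U], and otherwise once by the remaining
     chunks. *)
  rewrite /=; case E: (e a b) => /=; last first.
    by have := trailP _ _ _ tr a b; rewrite E; case: mult.
  case aU: (a \in U); first by rewrite Usat.
  by have := multU a b; case: mult => // k /(_ isT); rewrite aU.
Qed.

End Chunks.

(** * The order of the chunks *)

Section Layout.
Variables (V : finType) (prv : V -> V) (pos len idx : V -> nat) (M B : nat).
Hypothesis len_ge5 : forall v, 5 <= len v.
Hypothesis len_le : forall v, len v <= M.
Hypothesis idx_lt : forall v, idx v < B.
Hypothesis pos_lt_len : forall v, pos v < len v.
Hypothesis idx_pos_inj : forall u v, idx u = idx v -> pos u = pos v -> u = v.
Hypothesis idx_mono : forall u v, len u < len v -> idx u < idx v.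
Hypothesis idx_prv : forall v, idx (prv v) = idx v.
Hypothesis len_prv : forall v, len (prv v) = len v.
Hypothesis pos_prv : forall v,
  pos (prv v) = if pos v == 0 then (len v).-1 else (pos v).-1.

(* [idx] numbers the trails by increasing number of chunks and [pos] the chunks
   of a trail.  In an odd trail the front chunks get the levels 0, 2, 4, ... and
   the chunks from the back the levels 1, 1, 3, 5, ...; in an even trail the
   sublevel alternates between the two ends. *)
Definition level v :=
  if odd (len v) then
    if pos v < (len v)./2 then (pos v).*2
    else if (pos v).+1 == len v then 1 else (len v - pos v).*2 - 3
  else M.*2 + idx v.

Definition sublevel v :=
  if odd (len v) then (idx v).*2 + ((pos v).+1 == len v)
  else if pos v < (len v)./2 then (pos v).*2 else (len v - pos v).*2.-1.

(** Lexicographic order of level and sublevel as one number; the base exceeds every sublevel. *)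
Definition key v := level v * (B.*2 + M.*2).+2 + sublevel v.

Definition below u v :=
  level u < level v \/ (level u = level v /\ sublevel u < sublevel v).

Lemma idx_len u v : idx u = idx v -> len u = len v.
Proof. by move=> E; have := @idx_mono u v; have := @idx_mono v u; lia. Qed.

Lemma sublevel_lt v : sublevel v < (B.*2 + M.*2).+2.
Proof.
rewrite /sublevel; have := idx_lt v; have := len_le v; have := pos_lt_len v.
case: ifP => _; first by case: eqP => _ /=; lia.
by case: ifP => _; lia.
Qed.

Lemma below_key u v : below u v -> key u < key v.
Proof.
rewrite /key; have := sublevel_lt u; have := sublevel_lt v.
by move=> ? ?; rewrite /below => -[|[-> ]]; nia.
Qed.

(** Odd trails stay below level [M.*2]. There the sublevel gives the trail and the parity of the
    level gives the end, the two chunks at level 1 differing in the last bit of the sublevel. For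
    even trails the roles of level and sublevel are exchanged. *)
Lemma level_inj u v : level u = level v -> sublevel u = sublevel v -> u = v.
Proof.
move=> El Es.
have := idx_len (u := u) (v := v); have := pos_lt_len u; have := pos_lt_len v.
have := len_le u; have := len_le v; have := len_ge5 u; have := len_ge5 v.
suff : idx u = idx v -> len u = len v -> pos u = pos v.
  move: El Es; rewrite /level /sublevel => El Es H *; suff E : idx u = idx v.
    by apply: idx_pos_inj => //; apply: H => //; exact: idx_len.
  move: El Es; case: (odd (len u)); case: (odd (len v)) => //.
  - by do 2!case: eqP => _ /=; lia.
  - by do 2?[case: ifP => _]; lia.
  - by do 2?[case: ifP => _]; lia.
  - by lia.
move=> _ lE; move: El Es; rewrite /level /sublevel lE.
have := pos_lt_len u; have := pos_lt_len v; rewrite lE.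
have := odd_double_half (len v).
case: (odd (len v)) => /=.
  by do ![case: ifP => ?]; lia.
by do ![case: ifP => ?]; lia.
Qed.

Lemma key_inj : injective key.
Proof.
move=> u v E; case: (ltngtP (level u) (level v)) => El.
- by have := below_key (or_introl El : below u v); lia.
- by have := below_key (or_introl El : below v u); lia.
case: (ltngtP (sublevel u) (sublevel v)) => Es; last exact: level_inj.
- by have := below_key (or_intror (conj El Es) : below u v); lia.
- by have := below_key (or_intror (conj (esym El) Es) : below v u); lia.
Qed.

(* The pair of chunks meeting at a vertex where the orientation is reversed,
   the lower chunk first. *)
Variant reversal_spec v : V -> V -> Prop :=
| RevX a b h of len v = h.*2.+1 & 0 < pos v < h &
    level a = (pos v).*2 - 2 & level b = (pos v).*2 &
    sublevel a = (idx v).*2 & sublevel b = (idx v).*2 : reversal_spec v a b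
| RevTop a b h of len v = h.*2.+1 & pos v = h &
    level a = (pos v).*2 - 2 & level b = (pos v).*2 - 1 &
    sublevel a = (idx v).*2 & sublevel b = (idx v).*2 : reversal_spec v a b
| RevY a b h of len v = h.*2.+1 & h < pos v < h.*2 &
    level a = (len v - pos v).*2 - 3 & level b = (len v - pos v).*2 - 1 &
    sublevel a = (idx v).*2 & sublevel b = (idx v).*2 : reversal_spec v a b
| RevBottom a b h of len v = h.*2.+1 & pos v = h.*2 &
    level a = 1 & level b = 1 &
    sublevel a = (idx v).*2 & sublevel b = (idx v).*2.+1 : reversal_spec v a b
| RevEven a b h r of len v = h.*2 & level a = M.*2 + idx v &
    level b = M.*2 + idx v & sublevel a = r &
    (r = 0 /\ sublevel b = 1 /\ pos v = 0 \/
     pos v < h /\ r.+2 = (pos v).*2 /\ sublevel b = r.+2 \/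
     pos v = h /\ r = len v - 2 /\ sublevel b = r.+1 \/
     h < pos v /\ r.+1 = (len v - pos v).*2 /\ sublevel b = r.+2) :
    reversal_spec v a b.

(** In an odd trail the first and last chunks both have even position, hence the same direction;
    only their common vertex is not a reversal. *)
Definition flipped v := (0 < pos v) || ~~ odd (len v).

(** Along a trail the order rises up to the middle and falls afterwards, except that the last chunk
    of an odd trail lies just above its predecessor. *)
Lemma reversalP v : flipped v ->
  reversal_spec v (prv v) v \/ reversal_spec v v (prv v).
Proof.
rewrite /flipped => fv.
have := pos_lt_len v; have := len_ge5 v; have := len_le v.
have := odd_double_half (len v); have := pos_prv v.
have := erefl (level v); have := erefl (level (prv v)).
have := erefl (sublevel v); have := erefl (sublevel (prv v)).
rewrite {2 4}/sublevel {2 4}/level !len_prv !idx_prv.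
move: fv; case odd_l: (odd (len v)) => /=; rewrite ?orbF ?orbT.
  move=> pos0 + + + + pp; rewrite pp ifF; last by lia.
  move=> s2 s1 l2 l1 h g1 g2 g3.
  case: (ltngtP (pos v) (len v)./2) => ph.
  - left; apply: (RevX (h := (len v)./2)); [by lia|by lia|move: l2|move: l1|move: s2|move: s1].
    + by rewrite ifT; lia.
    + by rewrite ifT; lia.
    + by move=> ->; case: eqP => /=; lia.
    + by move=> ->; case: eqP => /=; lia.
  - case: (ltngtP (pos v) (len v).-1) => pl; last 1 first.
    + left; apply: (RevBottom (h := (len v)./2)); [by lia|by lia|move: l2|move: l1|move: s2|move: s1].
      * by rewrite ifF; last lia; rewrite ifF; lia.
      * by rewrite ifF; last lia; rewrite ifT; lia.
      * by move=> ->; case: eqP => /=; lia.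
      * by move=> ->; case: eqP => /=; lia.
    + right; apply: (RevY (h := (len v)./2)); [by lia|by lia|move: l1|move: l2|move: s1|move: s2].
      * by rewrite ifF; last lia; rewrite ifF; lia.
      * by rewrite ifF; last lia; rewrite ifF; lia.
      * by move=> ->; case: eqP => /=; lia.
      * by move=> ->; case: eqP => /=; lia.
    + by lia.
  - left; apply: (RevTop (h := (len v)./2)); [by lia|by lia|move: l2|move: l1|move: s2|move: s1].
    + by rewrite ifT; lia.
    + by rewrite ifF; last lia; rewrite ifF; lia.
    + by move=> ->; case: eqP => /=; lia.
    + by move=> ->; case: eqP => /=; lia.
move=> _ s2 s1 l2 l1 pp h g1 g2 g3.
have ol : ~~ odd (len v) by rewrite odd_l.
case: (posnP (pos v)) pp s1 s2 => [p0|p0] pp.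
  rewrite pp p0 /= ifT; last by lia.
  rewrite ifF => [s1 s2|]; last by lia.
  by right; apply: (RevEven (h := (len v)./2) (r := 0)) => //; left; rewrite s2; lia.
have {pp} -> : pos (prv v) = (pos v).-1 by [].
case: (ltngtP (pos v) (len v)./2) => ph s1.
- rewrite ifT; last by lia.
  by move=> s2; left; apply: (RevEven (h := (len v)./2) (r := (pos v).*2 - 2)) => //; lia.
- rewrite ifF; last by lia.
  by move=> s2; right; apply: (RevEven (h := (len v)./2) (r := (len v - pos v).*2.-1)) => //; lia.
- rewrite ifT; last by lia.
  by move=> s2; left; apply: (RevEven (h := (len v)./2) (r := len v - 2)) => //; lia.
Qed.

Lemma idx_cases u v :
  idx u < idx v /\ len u <= len v \/ idx v < idx u /\ len v <= len u \/
  idx u = idx v /\ len u = len v.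
Proof.
by have := @idx_len u v; have := @idx_mono u v; have := @idx_mono v u; lia.
Qed.

(** Equal parity means two sinks or two sources. It excludes crossing pairs, such as levels 0 and 2
    at position 1 against 1 and 1 at the bottom. Ties between levels are settled by [idx], which
    respects the lengths. *)
Lemma reversal_mono u v a b a' b' :
    odd (pos u) = odd (pos v) ->
    reversal_spec u a b -> reversal_spec v a' b' -> below a a' -> ~ below b' b.
Proof.
move=> par su sv; rewrite /below.
have := len_le u; have := len_le v.
have := pos_lt_len u; have := pos_lt_len v.
move: (odd_double_half (pos u)) (odd_double_half (pos v)); rewrite par.
move: (pos u)./2 (pos v)./2 (nat_of_bool (odd (pos v))) => pu pv r {par}.
have := idx_cases u v.
case: su => {}a {}b h => [-> ? -> -> -> ->|-> ? -> -> -> ->|-> ? -> -> -> ->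
  |-> ? -> -> -> ->|? -> -> -> -> ?];
case: sv => {}a' {}b' h' => [-> ? -> -> -> ->|-> ? -> -> -> ->|-> ? -> -> -> ->
  |-> ? -> -> -> ->|? -> -> -> -> ?];
by move=> [[? ?]|[[? ?]|[? ?]]] *; lia.
Qed.

Lemma reversal_inj u v a b a' b' :
    odd (pos u) = odd (pos v) -> a = a' -> b = b' ->
    reversal_spec u a b -> reversal_spec v a' b' -> u = v.
Proof.
move=> par aa bb su sv; suff [i p] : idx u = idx v /\ pos u = pos v.
  exact: idx_pos_inj.
have := len_le u; have := len_le v; have := idx_lt u; have := idx_lt v.
have := pos_lt_len u; have := pos_lt_len v.
move: (odd_double_half (pos u)) (odd_double_half (pos v)); rewrite par.
move: (pos u)./2 (pos v)./2 (nat_of_bool (odd (pos v))) => pu pv r {par}.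
have := idx_cases u v.
have := congr1 level aa; have := congr1 level bb.
have := congr1 sublevel aa; have := congr1 sublevel bb; move=> {aa bb}.
by case: su => {}a {}b h; case: sv => {}a' {}b' h' *; lia.
Qed.

Lemma below_total u v : below u v \/ below v u \/ u = v.
Proof.
rewrite /below; case: (ltngtP (level u) (level v)) => El; [by left; left|by right; left; left|].
case: (ltngtP (sublevel u) (sublevel v)) => Es; [by left; right|by right; left; right|].
by right; right; exact: level_inj.
Qed.

(** Used with [last_label] at sinks and [first_label] at sources: along a chain of pairs a strictly
    monotone [E] has strictly increasing sums. *)
Lemma reversal_sum_inj (E : V -> nat) u v :
    (forall x y, below x y -> E x < E y) ->
    flipped u -> flipped v -> odd (pos u) = odd (pos v) ->
    E (prv u) + E u = E (prv v) + E v ->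
  u = v.
Proof.
move=> Emono fu fv par Euv.
have [a [b [su Eu]]] : exists a b, reversal_spec u a b /\ E (prv u) + E u = E a + E b.
  by case: (reversalP fu) => su; [exists (prv u), u|exists u, (prv u)]; split=> //; lia.
have [a' [b' [sv Ev]]] : exists a b, reversal_spec v a b /\ E (prv v) + E v = E a + E b.
  by case: (reversalP fv) => sv; [exists (prv v), v|exists v, (prv v)]; split=> //; lia.
have lt x y x' y' : below x x' -> ~ below y' y -> E x + E y < E x' + E y'.
  move=> /Emono xx' nyy; have [/Emono|[/nyy//|->]] := below_total y y'; lia.
have [la|[la|la]] := below_total a a'.
- by have := lt _ _ _ _ la (reversal_mono par su sv la); lia.
- by have := lt _ _ _ _ la (reversal_mono (esym par) sv su la); lia.
have [/Emono lb|[/Emono lb|lb]] := below_total b b'; try by rewrite la in Eu; lia.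
exact: (reversal_inj par la lb su sv).
Qed.

(** * Labels of the chunks and comparison of the sums *)

Variable sz : V -> nat.
Hypothesis sz_gt0 : forall v, 0 < sz v.
Hypothesis sz_root : forall v, pos v = 0 -> sz v = 1.

Definition off v := \sum_(w | key w < key v) sz w.
Definition first_label v := (off v).+1.
Definition last_label v := off v + sz v.

Lemma key_below u v : key u < key v -> below u v.
Proof. by case: (below_total u v) => [//|[/below_key|->]]; lia. Qed.

Lemma last_labelE v : last_label v = \sum_(w | key w <= key v) sz w.
Proof.
rewrite /last_label [RHS](bigD1 v) //= addnC; congr (_ + _).
apply: eq_bigl => w; rewrite ltn_neqAle andbC; congr (_ && ~~ _).
by apply/eqP/eqP => [/key_inj|->].
Qed.

Lemma sum_sz_split (P Q : pred V) : (forall w, P w -> Q w) ->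
  \sum_(w | Q w) sz w = \sum_(w | P w) sz w + \sum_(w | Q w && ~~ P w) sz w.
Proof.
move=> PQ; rewrite (bigID P) /=; congr (_ + _); apply: eq_bigl => w.
by apply/andP/idP => [[_ Pw]|Pw] //; split=> //; exact: PQ.
Qed.

Lemma last_label_off u v : below u v -> last_label u <= off v.
Proof.
move=> /below_key lt; rewrite last_labelE /off.
rewrite (@sum_sz_split (fun w => key w <= key u) (fun w => key w < key v)) ?leq_addr //.
by move=> w; lia.
Qed.

Lemma last_label_lt u v : below u v -> last_label u < last_label v.
Proof. by move=> /last_label_off; have := sz_gt0 v; rewrite /last_label; lia. Qed.

Lemma first_label_lt u v : below u v -> first_label u < first_label v.
Proof.
by move=> /last_label_off; have := sz_gt0 u; rewrite /last_label /first_label; lia.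
Qed.

Lemma prv_inj : injective prv.
Proof.
move=> u v E; have := congr1 idx E; rewrite !idx_prv => iE.
apply: idx_pos_inj => //; have := congr1 pos E; rewrite !pos_prv (idx_len iE).
have := pos_lt_len u; have := pos_lt_len v; have := len_ge5 v; rewrite (idx_len iE).
by case: eqP; case: eqP; lia.
Qed.

Definition odd_root v := odd (len v) && (pos v == 0).

Lemma odd_rootP x : odd_root x ->
  [/\ level x = 0 /\ sublevel x = (idx x).*2,
      level (prv x) = 1 /\ sublevel (prv x) = (idx x).*2.+1 &
      level (prv (prv x)) = 1 /\ sublevel (prv (prv x)) = (idx x).*2].
Proof.
case/andP=> ol /eqP p0; have := len_ge5 x; have := odd_double_half (len x).
rewrite ol => h g.
have p1 : pos (prv x) = (len x).-1 by rewrite pos_prv p0.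
have p2 : pos (prv (prv x)) = (len x).-2.
  by rewrite pos_prv p1 ifF; lia.
rewrite /level /sublevel p1 p2 p0 !len_prv !idx_prv ol; split; split.
- by rewrite ifT; lia.
- by rewrite [_ == _]negbTE; lia.
- by rewrite ifF ?ifT; lia.
- by have -> : (len x).-1.+1 == len x; lia.
- by rewrite ifF ?ifF; lia.
- by rewrite [_ == _]negbTE; lia.
Qed.

(** So the first chunks of the odd trails are consecutive in the order, and each takes one label by
    [sz_root]. *)
Lemma level0_odd_root v : level v = 0 -> odd_root v.
Proof.
rewrite /level /odd_root; have := len_ge5 v; have := len_le v.
have := pos_lt_len v; have := odd_double_half (len v).
by case: odd => /=; last lia; case: ifP => ?; last case: ifP => ?; lia.
Qed.

(** Passing from [x] to [y], the first label grows by exactly [#|C|], while the last label grows by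
    at least [#|D|], and [#|D|] exceeds [#|C|]. *)
Lemma odd_root_sum_lt x y : odd_root x -> odd_root y -> idx x < idx y ->
  last_label (prv x) + first_label y < last_label (prv y) + first_label x.
Proof.
move=> rx ry ixy.
have [[lx sx] [lpx spx] _] := odd_rootP rx.
have [[ly sy] [lpy spy] [lppy sppy]] := odd_rootP ry.
pose C := [set w | (key w < key y) && ~~ (key w < key x)].
pose D := [set w | (key w <= key (prv y)) && ~~ (key w <= key (prv x))].
have kxy : key x < key y by apply: below_key; right; lia.
have kpxy : key (prv x) < key (prv y) by apply: below_key; right; lia.
have Cr w : w \in C -> [/\ odd_root w, idx x <= idx w & idx w < idx y].
  rewrite inE -leqNgt => /andP[/key_below wy]; rewrite leq_eqVlt => /orP[/eqP/key_inj <- //|].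
  move/key_below=> xw; have lw : level w = 0 by move: wy; rewrite /below; lia.
  have rw := level0_odd_root lw; have [[_ sw] _ _] := odd_rootP rw.
  by split=> //; move: wy xw; rewrite /below; lia.
have offC : off y = off x + #|C|.
  rewrite /off (@sum_sz_split (fun w => key w < key x) (fun w => key w < key y)) => [|w]; last by lia.
  congr (_ + _); rewrite -sum1_card; apply: eq_big => [w|w Cw]; first by rewrite inE.
  by apply: sz_root; have [|/andP[_ /eqP]] := Cr w; first by rewrite inE.
have lastD : last_label (prv x) + #|D| <= last_label (prv y).
  rewrite !last_labelE (@sum_sz_split (fun w => key w <= key (prv x)) (fun w => key w <= key (prv y))) => [|w].
    rewrite leq_add2l -sum1_card.
    rewrite [X in X <= _](eq_bigl (fun w => (key w <= key (prv y)) && ~~ (key w <= key (prv x)))).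
      by apply: leq_sum => w _; exact: sz_gt0.
    by move=> w; rewrite inE.
  by lia.
(* The last chunks of trails in [C], apart from [prv x], lie in [D], together with the last two
   chunks of the trail of [y]; this gives the surplus of one. *)
have sub : prv (prv y) |: (prv y |: prv @: C) \subset prv x |: D.
  apply/subsetP=> z; rewrite !inE => /orP[/eqP->|/orP[/eqP->|/imsetP[w wC ->]]].
  - apply/orP; right; rewrite -ltnNge; apply/andP; split; last first.
      by apply: below_key; right; lia.
    by apply: ltnW; apply: below_key; right; lia.
  - by apply/orP; right; rewrite leqnn -ltnNge.
  have [rw xw wy] := Cr w wC; have [_ [lpw spw] _] := odd_rootP rw.
  move: xw; rewrite leq_eqVlt => /orP[/eqP iE|xw].
    have -> : w = x.
      by apply: idx_pos_inj => //; case/andP: rw => _ /eqP->; case/andP: rx => _ /eqP->.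
    by rewrite eqxx.
  apply/orP; right; rewrite -ltnNge; apply/andP; split; last first.
    by apply: below_key; right; lia.
  by apply: ltnW; apply: below_key; right; lia.
have py : prv y \notin prv @: C.
  apply/imsetP=> -[w wC /prv_inj yw]; have [_ _] := Cr w wC; rewrite yw; lia.
have ppy : prv (prv y) \notin prv y |: prv @: C.
  rewrite !inE negb_or; apply/andP; split.
    by apply/eqP=> E; have := congr1 sublevel E; lia.
  apply/imsetP=> -[w wC E]; have [rw _ _] := Cr w wC.
  have [_ [_ spw] _] := odd_rootP rw; have := congr1 sublevel E; lia.
have := subset_leq_card sub; rewrite !cardsU1 ppy py card_imset; last exact: prv_inj.
by rewrite /first_label; case: (_ \notin _) => /=; lia.
Qed.

(** The sum at [v] up to a common constant, when even positions run forwards and odd ones backwards: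
    sink, start of an odd trail, source. *)
Definition chunk_value v : int :=
  (if odd (pos v) then (last_label (prv v))%:Z + (last_label v)%:Z
   else if odd_root v then (last_label (prv v))%:Z - (first_label v)%:Z
   else - ((first_label (prv v))%:Z + (first_label v)%:Z))%R.

(** Last chunks of odd trails have level 1. The only pair confined to level 1 is the bottom one,
    whose position is even, so a sink has a chunk of higher level. *)
Lemma sink_gt_root x v : odd_root x -> odd (pos v) ->
  last_label (prv x) < last_label (prv v) + last_label v.
Proof.
move=> rx ov; have fv : flipped v by rewrite /flipped; case: (pos v) ov.
have [_ [lpx _] _] := odd_rootP rx.
have lab b : 1 < level b -> last_label (prv x) < last_label b.
  by move=> lb; apply: last_label_lt; left; rewrite lpx.
have lev a b : reversal_spec v a b -> 1 < level b.
  move=> sp; have := len_ge5 v; have := len_le v.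
  have := odd_double_half (pos v); rewrite ov; move: (pos v)./2 => k.
  by case: sp => {}a {}b h *; lia.
by case: (reversalP fv) => /lev/lab; lia.
Qed.

Lemma odd_root_pos x : odd_root x -> first_label x < last_label (prv x).
Proof.
move=> rx; have [[lx _] [lpx _] _] := odd_rootP rx.
have : below x (prv x) by left; rewrite lx lpx.
move/last_label_off; have := sz_gt0 x; have := sz_gt0 (prv x).
by rewrite /last_label /first_label; lia.
Qed.

(** The three kinds have disjoint ranges: sources are negative, starts of odd trails positive, and
    sinks larger still. *)
Lemma chunk_value_inj : injective chunk_value.
Proof.
move=> u v; rewrite /chunk_value.
have fl w : ~~ odd_root w -> flipped w.
  by rewrite /odd_root /flipped; case: odd; case: (pos w).
have oddfl w : odd (pos w) -> ~~ odd_root w.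
  by rewrite /odd_root andbC; case: (pos w).
case ou: (odd (pos u)); case ov: (odd (pos v)).
- move=> E; apply: (reversal_sum_inj last_label_lt); rewrite ?fl ?oddfl ?ou ?ov //.
  by lia.
- case: (boolP (odd_root v)) => rv; last by rewrite /first_label; lia.
  by have := sink_gt_root rv ou; lia.
- case: (boolP (odd_root u)) => ru; last by rewrite /first_label; lia.
  by have := sink_gt_root ru ov; lia.
case: (boolP (odd_root u)) => ru; case: (boolP (odd_root v)) => rv; first last.
- move=> E; apply: (reversal_sum_inj first_label_lt); rewrite ?fl ?ou ?ov //.
  by lia.
- by have := odd_root_pos rv; rewrite /first_label; lia.
- by have := odd_root_pos ru; rewrite /first_label; lia.
move=> E; case: (ltngtP (idx u) (idx v)) => iuv.
- by have := odd_root_sum_lt ru rv iuv; lia.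
- by have := odd_root_sum_lt rv ru iuv; lia.
by apply: idx_pos_inj => //; case/andP: ru => _ /eqP->; case/andP: rv => _ /eqP->.
Qed.

End Layout.

(** * From ordered chunks to vertex sums *)

Section ArcLists.
Variable V : finType.
Implicit Types (a b u v x y : V) (p q : seq V) (e : rel V) (s : seq (V * V)).

(** The sum at [v] when the arcs of [s] carry the labels [k + 1], [k + 2], ... in order. *)
Fixpoint weight k s v : int :=
  if s is z :: s' then
    ((z.2 == v)%:Z * k.+1%:Z - (z.1 == v)%:Z * k.+1%:Z + weight k.+1 s' v)%R
  else 0%R.

Lemma weight_cat k s t v :
  weight k (s ++ t) v = (weight k s v + weight (k + size s) t v)%R.
Proof.
elim: s k => [|z s IHs] k /=; first by rewrite addn0; lia.
by rewrite IHs addSnnS; lia.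
Qed.

(** A passage enters with some label and leaves with the next, contributing -1. The start belongs to
    [belast] too, which turns its [- k] into [- (k + 1)]. *)
Lemma weight_arcs k x p v : weight k (arcs x p) v =
  ((last x p == v)%:Z * (k + size p)%:Z - (x == v)%:Z * k%:Z
   - (count_mem v (belast x p))%:Z)%R.
Proof.
elim: p x k => [|y p IHp] x k /=; first by case: eqP => _; lia.
rewrite IHp; case: (x == v); case: (y == v); case: (last y p == v); rewrite /= ?GRing.mul1r ?GRing.mul0r; lia.
Qed.

Definition back_arcs x p := arcs (last x p) (rev (belast x p)).

Lemma rev_walk x p :
  last (last x p) (rev (belast x p)) = x /\
  belast (last x p) (rev (belast x p)) = rev p.
Proof.
have := lastI (last x p) (rev (belast x p)).
rewrite -rev_rcons -lastI rev_cons => /rcons_inj[-> <-]; exact: conj.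
Qed.

Lemma mult_back_arcs a b x p : mult a b (back_arcs x p) = mult a b (arcs x p).
Proof.
rewrite /back_arcs; elim: p x => //= y p IHp x.
rewrite rev_cons arcs_rcons (rev_walk y p).1 -cats1 mult_cat IHp.
by rewrite /mult /= !xpair_eqE; lia.
Qed.

Lemma weight_back_arcs k x p v : weight k (back_arcs x p) v =
  ((x == v)%:Z * (k + size p)%:Z - (last x p == v)%:Z * k%:Z
   - (count_mem v p)%:Z)%R.
Proof.
rewrite weight_arcs (rev_walk x p).1 (rev_walk x p).2 size_rev size_belast.
by rewrite count_rev.
Qed.

Lemma set2_inj a b c d : [set a; b] = [set c; d] ->
  (a, b) = (c, d) \/ (a, b) = (d, c).
Proof.
move=> E; have := set21 a b; have := set22 a b; rewrite E !inE.
have := set21 c d; have := set22 c d; rewrite -E !inE.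
by do 4![move=> /orP[]/eqP ?]; subst; auto.
Qed.

Lemma mult_gt0 a b s : (0 < mult a b s) = ((a, b) \in s) || ((b, a) \in s).
Proof. by rewrite /mult addn_gt0 -!has_count !has_pred1. Qed.

Lemma mult_cons_lt a b s : mult a b s < mult a b ((a, b) :: s).
Proof. by rewrite -cat1s mult_cat -addn1 addnC leq_add2r mult_gt0 mem_head. Qed.

(** The list lists each edge once, in one direction: the direction is its orientation and its place
    in the list is its label. *)
Lemma arc_list_labeling e s :
    (forall a b, mult a b s = e a b) ->
  exists (o : rel V) f, [/\ orientation e o, edge_labeling e f &
    forall v, vertex_sum o f v = weight 0 s v].
Proof.
move=> me; pose S (z : V * V) := [set z.1; z.2].
have Su : uniq (map S s).
  have : forall a b, mult a b s <= 1 by move=> a b; rewrite me; case: (e a b).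
  elim: (s) => //= -[a b] t IHt H; rewrite IHt ?andbT => [|c d]; last first.
    by apply: leq_trans (H c d); rewrite /mult /=; lia.
  apply/mapP=> -[[c d] zt] /set2_inj /= Ez; have := mult_cons_lt a b t.
  suff : 0 < mult a b t by have := H a b; lia.
  by rewrite mult_gt0; case: Ez => -[-> ->]; rewrite zt ?orbT.
have su : uniq s := map_uniq Su.
have Sin a b : e a b -> [set a; b] \in map S s.
  move=> eab; have : 0 < mult a b s by rewrite me eab.
  rewrite mult_gt0 => /orP[abs|bas]; apply/mapP; first by exists (a, b).
  by exists (b, a); rewrite // /S setUC.
pose f A := (index A (map S s)).+1.
have fE z : z \in s -> f (S z) = (index z s).+1.
  move=> zs; rewrite /f -{1}(nth_index z zs) -(nth_map _ (S z)) ?index_mem //.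
  by rewrite index_uniq ?size_map ?index_mem.
have weightE k v : weight k s v =
    (\sum_(z <- s | z.2 == v) (k + (index z s).+1)%:Z
     - \sum_(z <- s | z.1 == v) (k + (index z s).+1)%:Z)%R.
  elim: (s) su k => [_ k|z t IHt] /=; first by rewrite !big_nil.
  case/andP=> zt ut k; rewrite !big_cons IHt //= eqxx.
  have E (P : pred (V * V)) :
      (\sum_(j <- t | P j) (k + (if z == j then 0 else (index j t).+1).+1)%:Z =
      \sum_(j <- t | P j) (k.+1 + (index j t).+1)%:Z)%R.
    rewrite big_seq_cond [RHS]big_seq_cond; apply: eq_bigr => j /andP[jt _].
    by rewrite ifN ?addSnnS //; apply: contraNneq zt => ->.
  rewrite (E (fun j => j.2 == v)) (E (fun j => j.1 == v)).
  rewrite !addn1; move: (\sum_(_ <- _ | _) _)%R (\sum_(_ <- _ | _) _)%R => S1 S2.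
  by case: (z.1 == v); case: (z.2 == v); rewrite /= ?GRing.mul1r ?GRing.mul0r; lia.
exists (fun a b => (a, b) \in s), f; split; [split; [|split]|split|].
- by move=> a b abs; have := mult_gt0 a b s; rewrite me abs; case: (e a b).
- move=> a b /Sin/mapP[[c d] cds] /set2_inj /= [] [-> ->]; by rewrite cds ?orbT.
- move=> a b; apply/negP=> /andP[h1 h2].
  have : 1 < mult a b s.
    by apply: (@leq_add 1 1); rewrite -has_count has_pred1.
  by rewrite me; case: (e a b).
- move=> A A' /imsetP[[a b]]; rewrite inE /= => eab ->.
  case/imsetP=> -[c d]; rewrite inE /= => ecd -> [].
  by move/(congr1 (nth set0 (map S s))); rewrite !nth_index ?Sin.
- move=> A /imsetP[[a b]]; rewrite inE /= => eab ->; rewrite /f /=.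
  have : index [set a; b] (map S s) < size (map S s) by rewrite index_mem Sin.
  move/leq_trans; apply; rewrite -(card_uniqP Su); apply: subset_leq_card.
  apply/subsetP=> _ /mapP[[c d] cds ->]; apply/imsetP; exists (c, d) => //.
  by rewrite inE /=; have := mult_gt0 c d s; rewrite me cds; case: (e c d).
- move=> v; rewrite weightE /vertex_sum; congr (_ - _)%R.
    rewrite -[RHS]big_filter [RHS]big_uniq ?filter_uniq //=.
    rewrite [RHS](reindex_onto (fun u => (u, v)) fst) /=; last first.
      by move=> [c d]; rewrite mem_filter /= => /andP[/eqP->].
    apply: eq_big => [u|u us]; first by rewrite mem_filter /= !eqxx andbT.
    by rewrite add0n -(fE (u, v) us).
  rewrite -[RHS]big_filter [RHS]big_uniq ?filter_uniq //=.
  rewrite [RHS](reindex_onto (fun u => (v, u)) snd) /=; last first.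
    by move=> [c d]; rewrite mem_filter /= => /andP[/eqP->].
  apply: eq_big => [u|u us]; first by rewrite mem_filter /= !eqxx andbT.
  by rewrite add0n -(fE (v, u) us).
Qed.

(** Strict sorting makes the blocks preceding [F u] exactly those of smaller key, which determines
    where its labels start. *)
Lemma weight_flatten (key sz : V -> nat) (F : V -> seq (V * V)) (t : seq V) v :
    (forall u, size (F u) = sz u) ->
    sorted (fun u w => key u < key w) t ->
  weight 0 (flatten (map F t)) v =
  (\sum_(u <- t) weight (\sum_(w <- t | (key w < key u)%N) sz w)%N (F u) v)%R.
Proof.
move=> szF; elim/last_ind: t => [|t z IHt] srt; first by rewrite big_nil.
have tr : transitive (fun u w => key u < key w) by move=> ? ? ?; exact: ltn_trans.
have ltz u : u \in t -> key u < key z.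
  by move=> ut; move: srt; rewrite sorted_pairwise // pairwise_rcons => /andP[/allP/(_ u ut)].
rewrite map_rcons flatten_rcons weight_cat IHt; last first.
  by move: srt; rewrite !sorted_pairwise // pairwise_rcons => /andP[].
rewrite -cats1 big_cat big_seq1 /=; congr (_ + weight _ _ _)%R.
  apply: eq_big_seq => u ut; congr weight; rewrite big_cat /= big_cons big_nil.
  by rewrite ltnNge ltnW ?ltz //= addn0.
rewrite add0n size_flatten /shape -map_comp sumnE big_map big_cat /= big_cons big_nil ltnn addn0.
rewrite [RHS]big_seq_cond [LHS]big_seq; apply: eq_big => [u|u _]; last exact: szF.
by case: (boolP (u \in t)) => //= ut; rewrite ltz.
Qed.

End ArcLists.

(** * Assembly for regular graphs of even degree *)

Lemma chunk_count (V : finType) (x v : V) p : 0 < size p ->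
  count_mem v p = (last x p == v) + (count_mem v p - (last x p == v)) /\
  count_mem v (belast x p) = (x == v) + (count_mem v p - (last x p == v)).
Proof.
move=> p0; have := count_belast v x p.
suff : (last x p == v) <= count_mem v p by lia.
by case: p p0 => // y p _; case: eqP => // <-; rewrite -has_count has_pred1 last_cons mem_last.
Qed.

Theorem even_regular_antimagic (d : nat) (V : finType) (e : rel V) :
  2 <= d -> simple_graph e -> regular e (2 * d) -> has_antimagic_orientation e.
Proof.
move=> d2 [esym eirr] reg.
have deg v : \sum_w e v w = 2 * d.
  by rewrite -(reg v) -sum1_card [RHS]big_mkcond; apply: eq_bigr => w _; rewrite inE; case: (e v w).
have even v : ~~ odd (\sum_w e v w) by rewrite deg; lia.
have [sg [pos [len [root ck]]]] := chunkingP esym eirr even.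
have av v : act e v.
  apply/existsP; have : #|[set w | e v w]| != 0 by rewrite reg; lia.
  by rewrite cards_eq0 => /set0Pn[w]; rewrite inE; exists w.
have sz_gt0 v : 0 < size (sg v) := chunk_gt0 ck (av v).
pose nxt v := last v (sg v).
have root_nxt v : root (nxt v) = root v by have [] := chunk_last ck (av v).
have pos_nxt v : pos (nxt v) = if (pos v).+1 == len v then 0 else (pos v).+1.
  by have [] := chunk_last ck (av v).
have pos_lt v : pos v < len v := pos_lt ck (av v).
have pos_inj u v := pos_inj ck (av u) (av v).
have len_root u v := len_root ck (av u) (av v).
have nxt_inj : injective nxt.
  move=> u v E; have rE : root u = root v by rewrite -root_nxt E root_nxt.
  apply: pos_inj => //; have := congr1 pos E; rewrite !pos_nxt (len_root _ _ rE).
  have := pos_lt u; have := pos_lt v; rewrite (len_root _ _ rE).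
  by case: eqP; case: eqP; lia.
pose prv := invF nxt_inj.
have nxtK v : nxt (prv v) = v by exact: f_invF.
have root_prv v : root (prv v) = root v by rewrite -{2}(nxtK v) root_nxt.
have len_prv v : len (prv v) = len v by exact: len_root.
have pos_prv v : pos (prv v) = if pos v == 0 then (len v).-1 else (pos v).-1.
  have := pos_nxt (prv v); have := pos_lt (prv v); rewrite nxtK len_prv.
  by case: eqP => ? ? ->; rewrite /=; lia.
pose M := \max_v len v.
have len_le v : len v <= M by exact: leq_bigmax.
(* Trails are ordered by length first, ties being broken by the rank of the root, which is below
   [#|V|]. *)
pose idx v := len v * #|V| + enum_rank (root v).
have rk v : enum_rank (root v) < #|V| by [].
have idx_lt v : idx v < M.+1 * #|V|.
  by rewrite /idx; have := rk v; have := len_le v; nia.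
have idx_mono u v : len u < len v -> idx u < idx v.
  by rewrite /idx; have := rk u; have := rk v; nia.
have idx_prv v : idx (prv v) = idx v by rewrite /idx len_prv root_prv.
have idx_pos_inj u v : idx u = idx v -> pos u = pos v -> u = v.
  move=> iE; apply: pos_inj; apply: enum_rank_inj; apply: val_inj => /=.
  have lE : len u = len v by have := @idx_mono u v; have := @idx_mono v u; lia.
  by move: iE; rewrite /idx lE => /addnI.
(* A vertex and its [2 * d] neighbours lie on one trail at distinct positions. *)
have len_ge5 v : 5 <= len v.
  pose A := v |: [set w | e v w].
  have cA : 5 <= #|A| by rewrite cardsU1 inE eirr reg /=; lia.
  apply: leq_trans cA _; rewrite cardE -(size_map pos) -(size_iota 0 (len v)).
  have rA w : w \in A -> root w = root v.
    by rewrite !inE => /orP[/eqP->//|/(root_edge ck)].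
  apply: uniq_leq_size.
    rewrite map_inj_in_uniq ?enum_uniq // => u w; rewrite !mem_enum => /rA ru /rA rw.
    by apply: pos_inj; rewrite ru rw.
  move=> n /mapP[w]; rewrite mem_enum => /rA rw ->.
  by rewrite mem_iota -(len_root _ _ rw) add0n pos_lt.
pose sz v := size (sg v).
have sz_root v : pos v = 0 -> sz v = 1 by exact: chunk1 ck _ (av v).
pose B := M.+1 * #|V|.
have vinj := @chunk_value_inj V prv pos len idx M B len_ge5 len_le idx_lt pos_lt
  idx_pos_inj idx_mono idx_prv len_prv pos_prv sz sz_gt0 sz_root.
pose F v := if odd (pos v) then back_arcs v (sg v) else arcs v (sg v).
have szF v : size (F v) = sz v.
  by rewrite /F /back_arcs; case: ifP => _; rewrite size_pairmap // size_rev size_belast.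
pose ky := key pos len idx M B.
have kinj : injective ky by exact: key_inj.
pose t := sort (relpre ky leq) (enum V).
have pt : perm_eq t (enum V) by rewrite perm_sort.
have st : sorted (fun u w => ky u < ky w) t.
  suff : sorted ltn (map ky t) by rewrite sorted_map.
  rewrite ltn_sorted_uniq_leq map_inj_uniq //.
  rewrite (perm_uniq pt) enum_uniq sorted_map; apply: sort_sorted.
  by move=> u w; exact: leq_total.
have mL a b : mult a b (flatten (map F t)) = e a b.
  rewrite mult_flatten big_map (perm_big _ pt) /= big_enum /= -(chunk_mult ck).
  by apply: eq_bigr => v _; rewrite /F; case: ifP; rewrite ?mult_back_arcs.
have [o [f [oo ff sumE]]] := arc_list_labeling mL.
exists o, f; split=> // u v; rewrite !sumE !(weight_flatten v szF st) !(weight_flatten u szF st).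
have offE w : \sum_(z <- t | ky z < ky w) sz z = off pos len idx M B sz w.
  by rewrite (perm_big _ pt) /= big_enum_cond.
(* Interior passages of the chunk of [u] through [v]. The degree [2 * d] is twice their total plus
   2, for the chunk starting at [v] and the one ending there. *)
pose inner v u := count_mem v (sg u) - (nxt u == v).
have innerE w : \sum_x inner w x = d.-1.
  have := deg w.
  under eq_bigr => b _ do rewrite -(chunk_mult ck).
  rewrite exchange_big /=.
  have -> : \sum_x \sum_b mult w b (arcs x (sg x)) =
      \sum_x ((x == w) + (nxt x == w) + (inner w x).*2).
    apply: eq_bigr => x _; rewrite sum_mult.
    by have [-> ->] := chunk_count x w (sz_gt0 x); rewrite -/(nxt x) -/(inner w x); lia.
  rewrite !big_split /=.
  have -> : \sum_x (x == w) = 1 by rewrite -big_mkcond /= big_pred1_eq.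
  have -> : \sum_x (nxt x == w) = 1.
    rewrite -big_mkcond /= (big_pred1 (prv w)) // => x.
    by rewrite /= -{1}(nxtK w) (inj_eq nxt_inj).
  have -> : \sum_x (inner w x).*2 = (\sum_x inner w x).*2.
    by rewrite (big_morph double doubleD double0).
  by lia.
have key_sum w : (\sum_(z <- t) weight (\sum_(y <- t | (ky y < ky z)%N) sz y)%N (F z) w =
    chunk_value prv pos len idx M B sz w - d.-1%:Z)%R.
  pose fl := first_label pos len idx M B sz; pose ll := last_label pos len idx M B sz.
  rewrite (perm_big _ pt) /= big_enum /=.
  (* [a z] and [b z] are the contributions of the chunk of [z] at its starting and end vertex; at
     [w] only [a w] and [b (prv w)] survive. *)
  pose a z : int := (if odd (pos z) then (ll z)%:Z else - (fl z)%:Z)%R.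
  pose b z : int := (if odd (pos z) then - (fl z)%:Z else (ll z)%:Z)%R.
  transitivity (\sum_z ((if z == w then a z else 0) + (if nxt z == w then b z else 0)
      - (inner w z)%:Z))%R.
    apply: eq_bigr => z _; rewrite offE /F /a /b /ll /fl /last_label /first_label.
    have [c1 c2] := chunk_count z w (sz_gt0 z).
    rewrite -/(nxt z) -/(inner w z) in c1 c2.
    case: (odd (pos z)); rewrite ?weight_back_arcs ?weight_arcs ?c1 ?c2 -/(nxt z) -/(sz z).
      by case: (z == w); case: (nxt z == w); rewrite ?GRing.mul1r ?GRing.mul0r; lia.
    by case: (z == w); case: (nxt z == w); rewrite ?GRing.mul1r ?GRing.mul0r; lia.
  rewrite GRing.sumrB big_split /= -!big_mkcond /= big_pred1_eq.
  rewrite (big_pred1 (prv w)) => [|x]; last by rewrite /= -{1}(nxtK w) (inj_eq nxt_inj).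
  rewrite -(innerE w) (big_morph Posz PoszD (erefl 0%:Z)%R); congr (_ - _)%R.
  rewrite /a /b /chunk_value /odd_root pos_prv -/ll -/fl.
  have := odd_double_half (len w); have := len_ge5 w.
  case: (posnP (pos w)) => [->|p0] h g /=; rewrite ?andbT ?andbF.
    have -> : odd (len w).-1 = ~~ odd (len w) by lia.
    by case: (odd (len w)) => /=; lia.
  have -> : odd (pos w).-1 = ~~ odd (pos w) by lia.
  by case: (odd (pos w)) => /=; lia.
by rewrite !key_sum => E; apply: vinj; lia.
Qed.

Theorem theorem1 (d : nat) (V : finType) (e : rel V) :
  2 <= d ->
  simple_graph e ->
  regular e (2 * d) ->
  let k := #|odd_components e| in
  (k <= 5 * d + 4 -> has_antimagic_orientation e) /\
  (5 * d + 5 <= k ->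
   forall x0 : nat, 0 < x0 ->
   ((exists2 r, r <= d + 8 & k = (2 * d - 2) * (x0 + 2) + r) \/
    (exists2 r, d + 9 <= r <= 2 * d - 3 & k = (2 * d - 2) * (x0 + 1) + r)) ->
   (forall C, C \in odd_components e -> 2 * x0 + 5 <= #|C|) ->
   has_antimagic_orientation e).
Proof.
move=> d2 sg reg k; have anti := even_regular_antimagic d2 sg reg.
by split=> [_|_ x0 _ _ _].
Qed.
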